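(* There exist a constant $C$ and a sequence $\epsilon_n\ge0$ with $\epsilon_n\to0$ as $n\to\infty$ ($C$ and $\epsilon_n$ independent of $u$ and $f$, and $C$ independent of $n$) such that the following holds. Let $f\in L^2(\Omega)$, let $u\in V$ be the solution of $\mathcal{L}u=f$, i.e. $a(u,v)=(f,v)_{L^2(\Omega)}$ for all $v\in V$, and for $n\ge0$ let $u_{S}\in V_S^n$ be the Galerkin finite element solution in the LSSI multiscale space $V_S^n$, i.e. $a(u_S,v)=(f,v)_{L^2(\Omega)}$ for all $v\in V_S^n$. Then $$\|u-u_S\|_a\le\sqrt{\lambda^{L+1}}\;\sum_{i=1}^{N_c}\|\mathcal{L}\chi_iu\|_{L^2(\Omega)}+C\left(\lambda^{\frac{L+1}{L}}+\epsilon_n\right)^n\|u\|_{L^2(\Omega)},$$ where $\lambda^{L+1}:=\max_i\lambda_i^{L_i+1}$ and $\lambda^{\frac{L+1}{L}}:=\max_i\dfrac{\lambda_i^{L_i+1}}{\lambda_i^{L_i}}$.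
   Context: Setting. $\Omega\subset\mathbb{R}^d$ is a polyhedral Lipschitz domain; $V$ is a Sobolev space on $\Omega$ (incorporating homogeneous Dirichlet boundary conditions) compactly embedded in $L^2(\Omega)$. $\mathcal{L}$ is a self-adjoint positive definite linear partial differential operator with associated bounded Hermitian positive definite sesquilinear form $a(\cdot,\cdot)$ on $V$, $a(u,v)=(\mathcal{L}u,v)_{L^2(\Omega)}$, and the problem $\mathcal{L}u=f$ is well-posed: for each $f\in L^2(\Omega)$ there is a unique $u\in V$ with $a(u,v)=(f,v)_{L^2(\Omega)}$ for all $v\in V$. The energy norm is $\|v\|_a^2=a(v,v)$. For $w\in V$, $\mathcal{L}w\in L^2(\Omega)$ means there is $g=:\mathcal{L}w\in L^2(\Omega)$ with $a(w,v)=(g,v)_{L^2(\Omega)}$ for all $v\in V$; if no such $g$ exists, $\|\mathcal{L}w\|_{L^2(\Omega)}$ is interpreted as $+\infty$. Forms and inner products are linear in the first and conjugate-linear in the second argument. Localization. $\{\omega_i\}_{i=1}^{N_c}$ is a finite open cover of $\Omega$, $\Omega=\bigcup_i\omega_i$, and $\{\chi_i\}_{i=1}^{N_c}$ is a partition of unity by bounded functions, $\sum_i\chi_i=1$, with $\chi_i$ supported on (the closure of) $\omega_i$. $V(\omega_i)$ is the space of $v\in V$ supported on $\omega_i$ (vanishing outside $\omega_i$); the partition of unity is such that $\chi_iv\in V(\omega_i)$ for all $v\in V$. $\mathcal{L}_i$ is the restriction of $\mathcal{L}$ to $V(\omega_i)$: for $f\in L^2(\omega_i)$, $\mathcal{L}_i^{-1}f\in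 V(\omega_i)$ is the unique solution of $a(\mathcal{L}_i^{-1}f,v)=(f,v)_{L^2(\omega_i)}$ for all $v\in V(\omega_i)$. $\mathcal{L}_i^{-1}$ is compact and self-adjoint on $L^2(\omega_i)$. Local spectral problems. $(\lambda_i^j,\phi_i^j)$, $j=1,2,\dots$, are the eigenpairs $\mathcal{L}_i^{-1}\phi_i^j=\lambda_i^j\phi_i^j$, $\phi_i^j\in V(\omega_i)$, counted with multiplicity, ordered $\lambda_i^1\ge\lambda_i^2\ge\cdots>0$, with $\{\phi_i^j\}_j$ $L^2$-orthonormal and complete in $V(\omega_i)$. (In $\lambda_i^j$, $\lambda^{L+1}$, $\lambda^{\frac{L+1}{L}}$ the superscripts are labels, not powers.) LSSI spaces. For each $i$, let $L_i\ge1$ and let $\phi_i^{1,0},\dots,\phi_i^{L_i,0}\in V(\omega_i)$ be linearly independent initial basis functions. For $n=0,1,2,\dots$ put $q_i^{j,n}:=(\phi_i^{j,n},\cdot)_{L^2(\Omega)}$ and, for $k=1,\dots,L_i$, let $\phi_i^{k,n+1}\in V(\omega_i)$ and $\mu_i^{n+1}\in\mathbb{C}^{L_i}$ (depending on $k$) solve $$a(\phi_i^{k,n+1},v)+\sum_{j=1}^{L_i}\mu_i^{j,n+1}q_i^{j,n}(v)=0\ \ \forall v\in V(\omega_i),\qquad q_i^{j,n}(\phi_i^{k,n+1})=\delta_{jk},\ j=1,\dots,L_i.$$ Set $V_S^{i,n}:=\operatorname{span}\{\phi_i^{j,n}: j=1,\dots,L_i\}$ (which equals $\mathcal{L}_i^{-n}V_S^{i,0}$)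 and $V_S^n:=\sum_{i=1}^{N_c}V_S^{i,n}$ (functions extended by zero to $\Omega$). Standing assumption on the initial spaces. With $P_i$ the spectral (orthogonal) projector onto $\operatorname{span}\{\phi_i^1,\dots,\phi_i^{L_i}\}$, for each $i$ and each $j\le L_i$ there is a unique $s\in V_S^{i,0}$ with $P_is=\phi_i^j$. The constant $C$ may depend on the eigenfunctions $\phi_i^j$, the initial spaces $V_S^{i,0}$, the partition of unity, $N_c$ and the $L_i$. *)

(* Defs.v *)
From HB Require Import structures.
From mathcomp Require Import all_boot all_order all_algebra.
From mathcomp Require Import all_classical all_reals all_analysis.
From mathcomp.real_closed Require Import complex.
Set Implicit Arguments.
Unset Strict Implicit.
Unset Printing Implicit Defensive.

Import Order.TTheory GRing.Theory Num.Theory numFieldNormedType.Exports.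

Local Open Scope classical_set_scope.
Local Open Scope ring_scope.
Local Open Scope complex_scope.

(* * Lebesgue measure on R^d *)

Definition rV_display : measure_display. Proof. by constructor. Qed.

Section rV_measurable.
Context {R : realType}.
Variable d : nat.

(* The sigma-algebra generated by these sets is the Borel sigma-algebra of
   R^d. *)
Definition rV_cylinder : set (set 'rV[R]_d) :=
  [set A | exists i (B : set R), measurable B /\
     A = [set x : 'rV[R]_d | B (x ord0 i)]].

Let rV_measurable0 : <<s rV_cylinder >> set0.
Proof. exact: sigma_algebra0. Qed.

Let rV_measurableC A : <<s rV_cylinder >> A -> <<s rV_cylinder >> (~` A).
Proof. exact: sigma_algebraC. Qed.

Let rV_measurable_bigcup (F : (set 'rV[R]_d)^nat) :
  (forall i, <<s rV_cylinder >> (F i)) -> <<s rV_cylinder >> (\bigcup_i F i).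
Proof. exact: sigma_algebra_bigcup. Qed.

HB.instance Definition _ := @isMeasurable.Build rV_display
  'rV[R]_d <<s rV_cylinder >> rV_measurable0 rV_measurableC
  rV_measurable_bigcup.

Lemma measurable_coord (i : 'I_d) :
  measurable_fun setT (fun x : 'rV[R]_d => x ord0 i).
Proof.
move=> _ B mB; rewrite setTI; apply: sub_sigma_algebra.
by exists i, B.
Qed.

Lemma measurable_fun_rV d0 (T : measurableType d0) (f : T -> 'rV[R]_d) :
  (forall i, measurable_fun setT (fun t => f t ord0 i)) ->
  measurable_fun setT f.
Proof.
move=> mf _ A; rewrite setTI.
apply: (@smallest_sub _ _ _ [set A | measurable (f @^-1` A)]).
  split => /=.
  - by rewrite preimage_set0.
  - by move=> B mB; rewrite setTD preimage_setC; exact: measurableC.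
  - by move=> F mF; rewrite preimage_bigcup; exact: bigcup_measurable.
move=> _ [i [B [mB ->]]] /=.
by have := mf i measurableT B mB; rewrite setTI.
Qed.

End rV_measurable.

Section rV_lebesgue.
Context {R : realType}.

Definition rV_cons d (p : R * 'rV[R]_d) : 'rV[R]_d.+1 :=
  \row_i (if unlift ord0 i is Some j then p.2 ord0 j else p.1).

Definition rV_uncons d (x : 'rV[R]_d.+1) : R * 'rV[R]_d :=
  (x ord0 ord0, \row_i x ord0 (lift ord0 i)).

Lemma rV_consK d : cancel (@rV_cons d) (@rV_uncons d).
Proof.
case=> r v; congr pair; first by rewrite mxE unlift_none.
by apply/rowP => i; rewrite !mxE liftK.
Qed.

Lemma measurable_rV_cons d : measurable_fun setT (@rV_cons d).
Proof.
apply: measurable_fun_rV => i.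
rewrite (_ : (fun _ => _) = fun p : R * 'rV[R]_d =>
    if unlift ord0 i is Some j then p.2 ord0 j else p.1); last first.
  by apply/funext => p; rewrite mxE.
case: unlift => [j|]; last exact: measurable_fst.
exact: (measurableT_comp (@measurable_coord R d j)).
Qed.

Lemma measurable_rV_uncons d : measurable_fun setT (@rV_uncons d).
Proof.
apply/measurable_fun_pairP; split; first exact: measurable_coord.
apply: measurable_fun_rV => i.
rewrite (_ : (fun _ => _) = fun x : 'rV[R]_d.+1 => x ord0 (lift ord0 i)).
  exact: measurable_coord.
by apply/funext => x /=; rewrite mxE.
Qed.

Section step.
Local Open Scope ereal_scope.
Variables (l : {sigma_finite_measure set (measurableTypeR R) -> \bar R}).
Variables (d : nat) (m : {sigma_finite_measure set 'rV[R]_d -> \bar R}).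

Definition rV_lebesgue_step : set 'rV[R]_d.+1 -> \bar R :=
  pushforward (l \x m) (@rV_cons d).

Let step0 : rV_lebesgue_step set0 = 0.
Proof. by rewrite /rV_lebesgue_step /pushforward preimage_set0 measure0. Qed.

Let step_ge0 A : 0 <= rV_lebesgue_step A.
Proof. by rewrite /rV_lebesgue_step /pushforward measure_ge0. Qed.

Let mcons (A : set 'rV[R]_d.+1) :
  measurable A -> measurable (@rV_cons d @^-1` A).
Proof.
by move=> mA; rewrite -[X in measurable X]setTI; exact: measurable_rV_cons.
Qed.

Let step_sigma_additive : semi_sigma_additive rV_lebesgue_step.
Proof.
move=> F mF tF mUF; rewrite /rV_lebesgue_step /pushforward preimage_bigcup.
apply: measure_semi_sigma_additive.
- by move=> n; exact: mcons.
- apply/trivIsetP => /= i j _ _ ij; rewrite -preimage_setI.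
  by move/trivIsetP : tF => /(_ _ _ _ _ ij) ->//; rewrite preimage_set0.
- by rewrite -preimage_bigcup; exact: mcons.
Qed.

HB.instance Definition _ := isMeasure.Build _ _ _
  rV_lebesgue_step step0 step_ge0 step_sigma_additive.

Let step_sigma_finite : sigma_finite setT rV_lebesgue_step.
Proof.
have /sigma_finiteP[F [TF ndF Foo]] := sigma_finiteT l.
have /sigma_finiteP[G [TG ndG Goo]] := sigma_finiteT m.
exists (fun n => @rV_uncons d @^-1` (F n `*` G n)).
  apply/esym; rewrite -subTset => x _.
  have [n _ Fn] : (\bigcup_n F n) (x ord0 ord0) by rewrite -TF.
  have [k _ Gk] : (\bigcup_n G n) (\row_i x ord0 (lift ord0 i)) by rewrite -TG.
  exists (maxn n k) => //; split => /=.
  - by move: Fn; exact/subsetPset/ndF/leq_maxl.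
  - by move: Gk; exact/subsetPset/ndG/leq_maxr.
move=> n; have [mF Fn] := Foo n; have [mG Gn] := Goo n.
have mFG : measurable (F n `*` G n) by exact: measurableX.
split; first by rewrite -[X in measurable X]setTI; exact: measurable_rV_uncons.
rewrite /rV_lebesgue_step /pushforward -comp_preimage.
rewrite (_ : _ @^-1` _ = F n `*` G n).
  by rewrite product_measure1E// lte_mul_pinfty// ge0_fin_numE.
by rewrite (_ : _ \o _ = id)//; apply/funext => p; exact: rV_consK.
Qed.

HB.instance Definition _ := Measure_isSigmaFinite.Build _ _ _
  rV_lebesgue_step step_sigma_finite.
End step.

(* The Lebesgue measure of R^0 is the unit mass at its only point. *)
Fixpoint rV_lebesgue d : {sigma_finite_measure set 'rV[R]_d -> \bar R} :=
  if d is d'.+1 then rV_lebesgue_step (@lebesgue_measure R) (rV_lebesgue d')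
  else \d_ (0 : 'rV[R]_0).

Lemma measurable_rV_box d (B : 'I_d -> set R) :
  (forall i, measurable (B i)) ->
  measurable [set x : 'rV[R]_d | forall i, B i (x ord0 i)].
Proof.
move=> mB.
rewrite (_ : [set x : 'rV[R]_d | _] =
    \bigcap_(i in [set: 'I_d]) [set x | B i (x ord0 i)]).
  apply: fin_bigcap_measurable; first exact: finite_finset.
  by move=> i _; apply: sub_sigma_algebra; exists i, (B i).
by apply/seteqP; split => [x Bx i _|x Bx i] //=; exact: Bx.
Qed.

Lemma rV_lebesgue_box d (B : 'I_d -> set R) :
  (forall i, measurable (B i)) ->
  (rV_lebesgue d [set x : 'rV[R]_d | forall i, B i (x ord0 i)] =
  \prod_(i < d) @lebesgue_measure R (B i))%E.
Proof.
elim: d B => [|d IH] B mB.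
  by rewrite big_ord0 /= diracE mem_set // => -[].
rewrite big_ord_recl -(IH (fun i => B (lift ord0 i))) //=.
rewrite /rV_lebesgue_step /pushforward.
transitivity ((@lebesgue_measure R \x rV_lebesgue d)%E
    (B ord0 `*` [set x : 'rV[R]_d | forall i, B (lift ord0 i) (x ord0 i)])).
  congr (product_measure1 _ _ _); apply/seteqP; split=> -[r x] /=.
    move=> Bx; split=> [|i]; first by have := Bx ord0; rewrite mxE unlift_none.
    by have := Bx (lift ord0 i); rewrite mxE liftK.
  by move=> [Br Bx] i; rewrite mxE; case: unliftP => [j|] ->.
rewrite product_measure1E //; first exact: mB.
by have := @measurable_rV_box d (fun i => B (lift ord0 i)) (fun i => mB _).

Qed.
End rV_lebesgue.

(* * Complex-valued functions on R^d, L^2 spaces *)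

Section L2.
Context {R : realType}.
Variable d : nat.

Local Notation E := 'rV[R]_d.
Local Notation fn := (E -> R[i]).
Local Notation mu := (rV_lebesgue d).

(* Functions stand for their classes modulo equality a.e. on the domain D;
   their values outside D are irrelevant. *)
Definition aeq (D : set E) (f g : fn) := {ae mu, forall x, D x -> f x = g x}.

Definition cmeasurable (D : set E) (f : fn) :=
  measurable_fun D (fun x => complex.Re (f x)) /\
  measurable_fun D (fun x => complex.Im (f x)).

Definition cintegrable (D : set E) (f : fn) :=
  mu.-integrable D (fun x => (complex.Re (f x))%:E) /\
  mu.-integrable D (fun x => (complex.Im (f x))%:E).

Definition cintegral (D : set E) (f : fn) : R[i] :=
  (\int[mu]_(x in D) complex.Re (f x)) +i*
  (\int[mu]_(x in D) complex.Im (f x)).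

Definition L2 (D : set E) : set fn := [set f | cmeasurable D f /\
  (\int[mu]_(x in D)
     (complex.Re (f x) ^+ 2 + complex.Im (f x) ^+ 2)%:E < +oo)%E].

Definition ip (D : set E) (f g : fn) : R[i] :=
  cintegral D (fun x => f x * (g x)^*).

Definition L2norm (D : set E) (f : fn) : R := Num.sqrt (complex.Re (ip D f f)).

End L2.

(* * Polyhedral Lipschitz domains *)

Section domain.
Context {R : realType}.
Variable d : nat.

Local Notation E := 'rV[R]_d.

Definition dot (x y : E) : R := \sum_i x ord0 i * y ord0 i.

Definition boundary (A : set E) := closure A `\` interior A.

(* Near every boundary point, Omega is the strict epigraph, in some unit
   direction e, of a Lipschitz function of the coordinates orthogonal to e. *)
Definition lipschitz_boundary (Omega : set E) := forall x, boundary Omega x ->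
  exists (e : E) (g : E -> R) (K r : R),
    [/\ dot e e = 1, 0 < r,
        forall y t, g (y + t *: e) = g y,
        forall y z, `|g y - g z| <= K * `|y - z|
      & forall y, ball x r y -> (Omega y <-> g y < dot y e)].

Definition polyhedral (Omega : set E) :=
  exists (N : nat) (H : 'I_N -> seq (E * R)),
    closure Omega = [set x | exists k, forall h, h \in H k -> dot h.1 x <= h.2].

Definition polyhedral_lipschitz_domain (Omega : set E) :=
  [/\ [/\ open Omega, connected Omega & Omega !=set0],
      bounded_set Omega, polyhedral Omega & lipschitz_boundary Omega].

End domain.

(* * Sobolev spaces *)

Section sobolev.
Context {R : realType}.
Variable d : nat.

Local Notation E := 'rV[R]_d.
Local Notation fn := (E -> R[i]).

Definition pd (i : 'I_d) (f : E -> R) : E -> R :=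
  fun x => 'D_(delta_mx ord0 i) f x.

Definition smooth (f : E -> R) := forall s : seq 'I_d,
  continuous (foldr pd f s) /\
  forall i x, derivable (foldr pd f s) x (delta_mx ord0 i).

(* C_c^oo(U) *)
Definition test_function (U : set E) (f : E -> R) :=
  [/\ smooth f, compact (closure [set x | f x != 0])
    & closure [set x | f x != 0] `<=` U].

Definition mpd (al : 'I_d -> nat) (f : E -> R) : E -> R :=
  foldr (fun i => iter (al i) (pd i)) f (enum 'I_d).

Definition morder (al : 'I_d -> nat) : nat := (\sum_i al i)%N.

Definition is_weak_derivative (Omega : set E) (al : 'I_d -> nat) (w g : fn) :=
  L2 Omega g /\ forall f, test_function Omega f ->
    cintegral Omega (fun x => w x * (mpd al f x)%:C) =
    (-1) ^+ morder al * cintegral Omega (fun x => g x * (f x)%:C).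

(* The weak derivative in L^2 (unique up to equality a.e.), when it exists. *)
Definition weak_derivative (Omega : set E) (al : 'I_d -> nat) (w : fn) : fn :=
  xget (fun=> 0) [set g | is_weak_derivative Omega al w g].

(* The multi-indices of order at most m are the al : mindex m such that
   morder al <= m. *)
Definition mindex (m : nat) := {ffun 'I_d -> 'I_m.+1}.
Definition mindex_nat m (al : mindex m) : 'I_d -> nat := fun i => al i.
Local Coercion mindex_nat : mindex >-> Funclass.

(* H^m(Omega) *)
Definition sobolev (Omega : set E) (m : nat) : set fn := [set w | L2 Omega w /\
  forall al : mindex m, (morder al <= m)%N ->
    exists g, is_weak_derivative Omega al w g].

Definition sobolev_norm (Omega : set E) (m : nat) (w : fn) : R :=
  Num.sqrt (\sum_(al : mindex m | (morder al <= m)%N)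
    L2norm Omega (weak_derivative Omega al w) ^+ 2).

(* The closure in H^m(Omega) of the restrictions to Omega of the functions of
   C_c^oo(R^d \ Gamma): vanishing traces on Gamma. It is H^m_0(Omega) when
   Gamma is the boundary of Omega. *)
Definition sobolev_dirichlet (Omega : set E) (m : nat) (Gamma : set E) :
  set fn := [set w | sobolev Omega m w /\ forall e : R, 0 < e ->
    exists f g, [/\ test_function (~` Gamma) f, test_function (~` Gamma) g
      & sobolev_norm Omega m (fun x => w x - (f x +i* g x)) < e]].

Definition subspace (V : set fn) := V (fun=> 0) /\
  forall (c : R[i]) u v, V u -> V v -> V (fun x => c * u x + v x).

(* V is a space of Sobolev type of order m on Omega, with homogeneous Dirichlet
   conditions on the nonempty part GammaD of the boundary (and possibly further
   ones), compactly embedded in L^2(Omega). Its norm is that of H^m(Omega). *)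
Record sobolev_space (Omega : set E) (m : nat) (GammaD : set E) (V : set fn)
    : Prop := SobolevSpace {
  order_gt0 : (0 < m)%N ;
  dirichlet_part : [/\ GammaD !=set0, closed GammaD
    & GammaD `<=` boundary Omega] ;
  space_aeq : forall u v, aeq Omega u v -> V u -> L2 Omega v -> V v ;
  space_linear : subspace V ;
  space_sobolev : V `<=` sobolev Omega m ;
  space_closed : forall w, sobolev Omega m w ->
    (forall e : R, 0 < e ->
      exists2 v, V v & sobolev_norm Omega m (w \- v) < e) -> V w ;
  space_dirichlet : V `<=` sobolev_dirichlet Omega 1 GammaD ;
  space_core : sobolev_dirichlet Omega m (boundary Omega) `<=` V ;
  space_compact : forall (v : nat -> fn) (M : R),
    (forall n, V (v n) /\ sobolev_norm Omega m (v n) <= M) ->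
    exists (k : nat -> nat) (w : fn),
      [/\ {homo k : p q / (p < q)%N}, L2 Omega w
        & (fun n => L2norm Omega (v (k n) \- w)) @ \oo --> (0 : R)]
}.

End sobolev.
Coercion mindex_nat : mindex >-> Funclass.

(* * The variational problem and the localized spaces *)

Section variational.
Context {R : realType}.
Variable d : nat.

Local Notation E := 'rV[R]_d.
Local Notation fn := (E -> R[i]).

(* a is the form of the self-adjoint positive definite operator
     L u = sum_(al, be) (-1)^|al| D^al (c_(al, be) D^be u),
   whose order is at most 2m. *)
Record pde_form (Omega : set E) (m : nat) (V : set fn) (a : fn -> fn -> R[i])
    : Prop := PdeForm {
  form_aeq : forall u u' v, V u -> V u' -> V v -> aeq Omega u u' ->
    a u v = a u' v ;
  form_linear : forall (c : R[i]) u v w, V u -> V v -> V w ->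
    a (fun x => c * u x + v x) w = c * a u w + a v w ;
  form_hermitian : forall u v, V u -> V v -> a v u = (a u v)^* ;
  form_positive : forall v, V v -> ~ aeq Omega v (fun=> 0) -> 0 < a v v ;
  form_bounded : exists M : R, forall u v, V u -> V v ->
    `|a u v| <= (M * sobolev_norm Omega m u * sobolev_norm Omega m v)%:C ;
  form_operator : exists c : mindex d m -> mindex d m -> fn,
    (forall al be, cmeasurable Omega (c al be)) /\
    forall u v, V u -> V v ->
      let h (al be : mindex d m) x := c al be x *
        weak_derivative Omega be u x * (weak_derivative Omega al v x)^* in
      (forall al be : mindex d m, (morder al <= m)%N -> (morder be <= m)%N ->
         cintegrable Omega (h al be)) /\
      a u v = \sum_(al : mindex d m | (morder al <= m)%N)
        \sum_(be : mindex d m | (morder be <= m)%N) cintegral Omega (h al be)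
}.

Definition energy_norm (a : fn -> fn -> R[i]) (v : fn) : R :=
  Num.sqrt (complex.Re (a v v)).

Definition is_solution (a : fn -> fn -> R[i]) (W : set fn) (D : set E)
    (f u : fn) :=
  W u /\ forall v, W v -> a u v = ip D f v.

Definition well_posed (Omega : set E) (a : fn -> fn -> R[i]) (W : set fn)
    (D : set E) :=
  forall f, L2 D f -> exists2 u, is_solution a W D f u &
    forall u', is_solution a W D f u' -> aeq Omega u' u.

(* The solution operator f |-> u, meaningful for a well-posed problem. *)
Definition solution_op (a : fn -> fn -> R[i]) (W : set fn) (D : set E)
    (f : fn) : fn :=
  xget (fun=> 0) [set u | is_solution a W D f u].

(* g is L w. *)
Definition is_operator_value (Omega : set E) (a : fn -> fn -> R[i])
    (V : set fn) (w g : fn) :=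
  L2 Omega g /\ forall v, V v -> a w v = ip Omega g v.

(* The L^2 norm of L w, which is +oo if L w is not in L^2(Omega). *)
Definition operator_value_norm (Omega : set E) (a : fn -> fn -> R[i])
    (V : set fn) (w : fn) : \bar R :=
  if `[< exists g, is_operator_value Omega a V w g >]
  then (L2norm Omega
    (xget (fun=> 0) [set g | is_operator_value Omega a V w g]))%:E
  else +oo%E.

(* V(omega) *)
Definition local_space (Omega : set E) (V : set fn) (omega : set E) : set fn :=
  [set v | V v /\ aeq (Omega `\` omega) v (fun=> 0)].

Record partition_of_unity (Omega : set E) (V : set fn) (N : nat)
    (omega : 'I_N -> set E) (chi : 'I_N -> fn) : Prop := PartitionOfUnity {
  cover_open : forall i, open (omega i) ;
  cover_eq : Omega = \bigcup_(i in setT) omega i ;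
  partition_measurable : forall i, cmeasurable Omega (chi i) ;
  partition_bounded : exists M : R, forall i x, Omega x ->
    `|chi i x| <= M%:C ;
  partition_support : forall i,
    aeq (Omega `\` closure (omega i)) (chi i) (fun=> 0) ;
  partition_sum : aeq Omega (fun x => \sum_i chi i x) (fun=> 1) ;
  partition_local : forall i v, V v ->
    local_space Omega V (omega i) (fun x => chi i x * v x)
}.

(* The indices j start at 0: lam j and phi j are the (j+1)-st eigenvalue and
   eigenfunction. *)
Record eigenpairs (Omega : set E) (a : fn -> fn -> R[i]) (V : set fn)
    (omega : set E) (lam : nat -> R) (phi : nat -> fn) : Prop := Eigenpairs {
  eigen_local : forall j, local_space Omega V omega (phi j) ;
  eigen_eq : forall j,
    aeq Omega (solution_op a (local_space Omega V omega) omega (phi j))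
      (fun x => (lam j)%:C * phi j x) ;
  eigen_decreasing : forall j, lam j.+1 <= lam j ;
  eigen_gt0 : forall j, 0 < lam j ;
  eigen_orthonormal : forall j k, ip Omega (phi j) (phi k) = (j == k)%:R ;
  eigen_complete : forall v (e : R), local_space Omega V omega v -> 0 < e ->
    exists N (c : 'I_N -> R[i]),
      L2norm Omega (fun x => v x - \sum_j c j * phi j x) < e
}.

Definition spectral_projector (Omega : set E) (k : nat) (phi : nat -> fn)
    (s : fn) : fn :=
  fun x => \sum_(j < k) ip Omega s (phi j) * phi j x.

Definition span_of (Omega : set E) (k : nat) (phi : 'I_k -> fn) : set fn :=
  [set w | L2 Omega w /\
    exists c : 'I_k -> R[i], aeq Omega w (fun x => \sum_j c j * phi j x)].

(* For one subdomain: phi n k is the k-th basis function after n iterations. *)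
Record lssi_basis (Omega : set E) (a : fn -> fn -> R[i]) (V : set fn)
    (omega : set E) (L : nat) (phi : nat -> 'I_L -> fn) : Prop := LssiBasis {
  lssi_local : forall n k, local_space Omega V omega (phi n k) ;
  lssi_free : forall c : 'I_L -> R[i],
    aeq Omega (fun x => \sum_j c j * phi 0%N j x) (fun=> 0) ->
    forall j, c j = 0 ;
  lssi_step : forall n k, exists mu : 'I_L -> R[i],
    (forall v, local_space Omega V omega v ->
       a (phi n.+1 k) v + \sum_j mu j * ip Omega (phi n j) v = 0) /\
    forall j, ip Omega (phi n j) (phi n.+1 k) = (j == k)%:R
}.

Definition lssi_space (Omega : set E) (N : nat) (L : 'I_N -> nat)
    (phi : forall i, nat -> 'I_(L i) -> fn) (n : nat) : set fn :=
  [set w | L2 Omega w /\ exists ws : 'I_N -> fn,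
    (forall i, span_of Omega (phi i n) (ws i)) /\
    aeq Omega w (fun x => \sum_i ws i x)].

(* Each eigenfunction ephi j, j < L, has exactly one preimage in V0 under the
   spectral projector. *)
Definition unique_preimages (Omega : set E) (L : nat) (ephi : nat -> fn)
    (V0 : set fn) :=
  forall j, (j < L)%N -> exists2 s,
    V0 s /\ aeq Omega (spectral_projector Omega L ephi s) (ephi j) &
    forall s', V0 s' ->
      aeq Omega (spectral_projector Omega L ephi s') (ephi j) -> aeq Omega s' s.

End variational.

(* Main.v *)
(** Galerkin's solution is energy-optimal in [V_S^n], so it is enough to
    approximate each [chi_i u] in [V_S^{i,n}] and add up. Let [P] be the
    projector onto the first [L] local eigenfunctions. Completeness and Bessel's
    inequality for the energy form give the Rayleigh bound
    [|r|^2 <= lambda^{L+1} |r|_a^2] whenever [P r = 0]. Applied to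
    [r = chi_i u - P chi_i u], whose energy is [(L chi_i u, r)], it yields the
    first term. For the second one, pick [s] in [V_S^{i,0}] with [P s = phi^j];
    then [e_n = L_i^{-n} s - (lambda^j)^n phi^j] satisfies
    [a(e_{n+1}, v) = (e_n, v)] and [P e_n = 0], so that
    [|e_{n+1}|_a <= lambda^{L+1} |e_n|_a], and
    [(lambda^j)^{-n} L_i^{-n} s] in [V_S^{i,n}] approximates [phi^j] at the rate
    [(lambda^{L+1} / lambda^L)^n]. In particular [epsilon_n = 0] works. *)
Require Import Defs.
From HB Require Import structures.
From mathcomp Require Import all_boot all_order all_algebra.
From mathcomp Require Import all_classical all_reals all_analysis.
From mathcomp.real_closed Require Import complex.
From mathcomp Require Import measurable_realfun lra ring.
Set Implicit Arguments.
Unset Strict Implicit.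
Unset Printing Implicit Defensive.

Import Order.TTheory GRing.Theory Num.Theory numFieldNormedType.Exports.
Import ComplexField.Normc.
Local Open Scope classical_set_scope.
Local Open Scope ring_scope.
Local Open Scope complex_scope.

(** * Real parts and moduli of complex numbers *)

Section complex_facts.
Context {R : rcfType}.
Implicit Types (x y : R[i]) (r : R).

Lemma ReD x y : complex.Re (x + y) = complex.Re x + complex.Re y.
Proof. by case: x y => ? ? []. Qed.

Lemma ReN x : complex.Re (- x) = - complex.Re x.
Proof. by case: x. Qed.

Lemma Re_conjc x : complex.Re (conjc x) = complex.Re x.
Proof. by case: x. Qed.

Lemma ReZ r x : complex.Re (r%:C * x) = r * complex.Re x.
Proof. by case: x => u v /=; rewrite mul0r subr0. Qed.

Lemma Re_sum (I : finType) (P : pred I) (F : I -> R[i]) :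
  complex.Re (\sum_(i | P i) F i) = \sum_(i | P i) complex.Re (F i).
Proof. exact: (big_morph _ ReD). Qed.

Lemma normc_ge0 x : 0 <= normc x.
Proof. by case: x => u v /=; exact: sqrtr_ge0. Qed.

Lemma mul_conjcE x : x * conjc x = (normc x ^+ 2)%:C.
Proof. by rewrite -sqr_normc rmorphXn. Qed.

Lemma Re_mul_conjc x : complex.Re (x * conjc x) = normc x ^+ 2.
Proof. by rewrite mul_conjcE. Qed.

Lemma normc_conjc x : normc (conjc x) = normc x.
Proof. by case: x => u v /=; rewrite sqrrN. Qed.

Lemma normc_real r : normc r%:C = `|r|.
Proof. by rewrite /= expr0n addr0 sqrtr_sqr. Qed.

Lemma ge0_Re x : 0 <= x -> 0 <= complex.Re x.
Proof. by case: x => u v; rewrite lecE /= => /andP[]. Qed.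

End complex_facts.

Lemma conjcR (R : realType) (r : R) : conjc r%:C = r%:C.
Proof. exact: conjc_real. Qed.

(** * Semi-inner products *)

Section semi_inner_product.
Context {R : realType} {X : lmodType R[i]}.
Implicit Types (S : set X) (b : X -> X -> R[i]).

Definition linear_subspace S :=
  S 0 /\ forall (c : R[i]) u v, S u -> S v -> S (c *: u + v).

(** Functions stand for classes modulo equality a.e., so a nonzero function can have zero norm: the
    forms are definite only up to null functions, and their axioms hold only on the set [S]. *)
Record semi_inner S b : Prop := SemiInner {
  si_subspace : linear_subspace S ;
  si_linear : forall (c : R[i]) u v w, S u -> S v -> S w ->
    b (c *: u + v) w = c * b u w + b v w ;
  si_hermitian : forall u v, S u -> S v -> b v u = conjc (b u v) ;
  si_ge0 : forall v, S v -> 0 <= b v v }.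

(** For [b := ip Omega] this is [L2norm Omega], and for [b := a] it is [energy_norm a], both by
    conversion. *)
Definition snorm b v : R := Num.sqrt (complex.Re (b v v)).

Lemma linear_subspaceD S u v : linear_subspace S -> S u -> S v -> S (u + v).
Proof. by move=> [_ SL] Su Sv; rewrite -[u]scale1r; exact: SL. Qed.

Lemma linear_subspaceZ S c u : linear_subspace S -> S u -> S (c *: u).
Proof. by move=> [S0 SL] Su; rewrite -[_ *: _]addr0; exact: SL. Qed.

Lemma linear_subspaceB S u v : linear_subspace S -> S u -> S v -> S (u - v).
Proof.
by move=> SS Su Sv; apply: linear_subspaceD => //;
  rewrite -scaleN1r; exact: linear_subspaceZ.
Qed.

Lemma linear_subspace_sum S (I : finType) (F : I -> X) :
  linear_subspace S -> (forall i, S (F i)) -> S (\sum_i F i).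
Proof.
move=> SS SF; elim/big_ind: _ => //; first by case: SS.
by move=> u v; exact: linear_subspaceD.
Qed.

Lemma linear_subspace_comb {S} {I : finType} (c : I -> R[i]) (F : I -> X) :
  linear_subspace S -> (forall i, S (F i)) -> S (\sum_i c i *: F i).
Proof.
by move=> SS SF; apply: linear_subspace_sum => // i; exact: linear_subspaceZ.
Qed.

Lemma semi_inner_sub S S' b : semi_inner S b -> linear_subspace S' ->
  S' `<=` S -> semi_inner S' b.
Proof.
move=> Sb SS' S'S; split=> //.
- by move=> c u v w Su Sv Sw; apply: (si_linear Sb); exact: S'S.
- by move=> u v Su Sv; apply: (si_hermitian Sb); exact: S'S.
- by move=> v Sv; apply: (si_ge0 Sb); exact: S'S.
Qed.

Section theory.
Context {S : set X} {b : X -> X -> R[i]}.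
Hypothesis Sb : semi_inner S b.
Let SS : linear_subspace S := si_subspace Sb.
Let S0 : S 0 := proj1 SS.

Lemma siDl u v w : S u -> S v -> S w -> b (u + v) w = b u w + b v w.
Proof.
by move=> Su Sv Sw; rewrite -[u in LHS]scale1r (si_linear Sb) // mul1r.
Qed.

Lemma si0l w : S w -> b 0 w = 0.
Proof.
move=> Sw; apply: (addIr (b 0 w)).
by rewrite -siDl // add0r add0r.
Qed.

Lemma siZl c u w : S u -> S w -> b (c *: u) w = c * b u w.
Proof.
by move=> Su Sw; rewrite -[_ *: _]addr0 (si_linear Sb) // si0l // addr0.
Qed.

Lemma siNl u w : S u -> S w -> b (- u) w = - b u w.
Proof. by move=> Su Sw; rewrite -scaleN1r siZl // mulN1r. Qed.

Lemma siBl u v w : S u -> S v -> S w -> b (u - v) w = b u w - b v w.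
Proof.
move=> Su Sv Sw; rewrite siDl // ?siNl //.
by rewrite -scaleN1r; exact: linear_subspaceZ.
Qed.

Lemma si_combl (I : finType) (c : I -> R[i]) (F : I -> X) w :
  (forall i, S (F i)) -> S w ->
  b (\sum_i c i *: F i) w = \sum_i c i * b (F i) w.
Proof.
move=> SF Sw; suff [] : b (\sum_i c i *: F i) w = \sum_i c i * b (F i) w /\
    S (\sum_i c i *: F i) by [].
elim/big_rec2: _ => [|i z x _ [<- Sx]]; first by rewrite si0l.
by split; [rewrite (si_linear Sb) | apply: (proj2 SS)].
Qed.

Lemma siBr u v w : S u -> S v -> S w -> b w (u - v) = b w u - b w v.
Proof.
move=> Su Sv Sw; rewrite (si_hermitian Sb (u := u - v)) //; last first.
  exact: linear_subspaceB.
by rewrite siBl // rmorphB /= -!(si_hermitian Sb).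
Qed.

Lemma siDr u v w : S u -> S v -> S w -> b w (u + v) = b w u + b w v.
Proof.
move=> Su Sv Sw; rewrite (si_hermitian Sb (u := u + v)) //; last first.
  exact: linear_subspaceD.
by rewrite siDl // rmorphD /= -!(si_hermitian Sb).
Qed.

Lemma siZr c u w : S u -> S w -> b w (c *: u) = conjc c * b w u.
Proof.
move=> Su Sw; rewrite (si_hermitian Sb (u := c *: u)) //; last first.
  exact: linear_subspaceZ.
by rewrite siZl // rmorphM /= -(si_hermitian Sb).
Qed.

Lemma si_combr (I : finType) (c : I -> R[i]) (F : I -> X) w :
  (forall i, S (F i)) -> S w ->
  b w (\sum_i c i *: F i) = \sum_i conjc (c i) * b w (F i).
Proof.
move=> SF Sw; rewrite (si_hermitian Sb (u := \sum_i _)) //; last first.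
  exact: linear_subspace_comb.
rewrite si_combl // rmorph_sum /=; apply: eq_bigr => i _.
by rewrite rmorphM /= -(si_hermitian Sb).
Qed.

Lemma snorm_ge0 v : 0 <= snorm b v.
Proof. exact: sqrtr_ge0. Qed.

Lemma sqr_snorm v : S v -> snorm b v ^+ 2 = complex.Re (b v v).
Proof. by move=> Sv; rewrite sqr_sqrtr // ge0_Re // (si_ge0 Sb). Qed.

Lemma snormZ c v : S v -> snorm b (c *: v) = normc c * snorm b v.
Proof.
move=> Sv; have Scv : S (c *: v) by exact: linear_subspaceZ.
apply/eqP; rewrite -(eqrXn2 (n := 2)) ?snorm_ge0 ?mulr_ge0 ?normc_ge0
  ?snorm_ge0 //.
by rewrite exprMn !sqr_snorm // siZl // siZr // mulrA mul_conjcE ReZ.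
Qed.

Lemma Re_cauchy_schwarz u v : S u -> S v ->
  complex.Re (b u v) <= snorm b u * snorm b v.
Proof.
move=> Su Sv.
have quad (x y : R) : 0 <= x ^+ 2 * snorm b u ^+ 2
    - 2 * x * y * complex.Re (b u v) + y ^+ 2 * snorm b v ^+ 2.
  have Sx : S (x%:C *: u) by exact: linear_subspaceZ.
  have Sy : S (y%:C *: v) by exact: linear_subspaceZ.
  have Sxy := linear_subspaceB SS Sx Sy.
  apply: le_trans (_ : complex.Re (b (x%:C *: u - y%:C *: v)
    (x%:C *: u - y%:C *: v)) <= _); first exact: ge0_Re (si_ge0 Sb Sxy).
  rewrite siBl // !siBr // !siZl // !siZr // !conjcR.
  rewrite !(ReD, ReN, ReZ) (si_hermitian Sb Su Sv) Re_conjc -!sqr_snorm //.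
  lra.
set p := snorm b u; set q := snorm b v; set c := complex.Re _.
have p0 : 0 <= p by exact: snorm_ge0.
have q0 : 0 <= q by exact: snorm_ge0.
have [c0|c0] := lerP c 0; first by apply: le_trans c0 _; exact: mulr_ge0.
move: quad; rewrite -/p -/q -/c => quad.
have [q_eq0|q_neq0] := eqVneq q 0.
  (* A null [v] need not be zero. This choice of [y] turns the quadratic into
     [p ^+ 2 - 2 * (p ^+ 2 + 1)], which is negative. *)
  have := quad 1 ((p ^+ 2 + 1) / c).
  rewrite q_eq0 expr0n mulr0 addr0 expr1n mul1r mulr1 -mulrA divfK ?gt_eqF //.
  have := sqr_ge0 p; lra.
have q_gt0 : 0 < q by rewrite lt_def q_neq0.
rewrite -(ler_pXn2r (n := 2)) ?nnegrE ?mulr_ge0 ?(ltW c0) //.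
(* Here the quadratic is [q ^+ 2 * (p ^+ 2 * q ^+ 2 - c ^+ 2)], and [q ^+ 2] cancels. *)
have := quad (q ^+ 2) c; rewrite exprMn -(ler_pM2r (exprn_gt0 2 q_gt0)); lra.
Qed.

(** Scaling [u] by the conjugate of [b u v] makes the product real, equal to the squared modulus;
    the bound on real parts then applies, and one factor of the modulus cancels unless it is
    zero. *)
Lemma cauchy_schwarz u v : S u -> S v ->
  normc (b u v) <= snorm b u * snorm b v.
Proof.
move=> Su Sv; set z := b u v.
have Szu : S (conjc z *: u) by exact: linear_subspaceZ.
have := Re_cauchy_schwarz Szu Sv.
rewrite siZl // mulrC Re_mul_conjc snormZ // normc_conjc expr2 -mulrA.
have := normc_ge0 z; rewrite le_eqVlt => /predU1P[<- _|z0].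
  by rewrite mulr_ge0 ?snorm_ge0.
by rewrite ler_pM2l.
Qed.

Lemma snormD u v : S u -> S v -> snorm b (u + v) <= snorm b u + snorm b v.
Proof.
move=> Su Sv; have Suv := linear_subspaceD SS Su Sv.
rewrite -(ler_pXn2r (n := 2)) ?nnegrE ?addr_ge0 ?snorm_ge0 //.
rewrite sqr_snorm // siDl // !siDr // !ReD (si_hermitian Sb Su Sv) Re_conjc.
rewrite -!sqr_snorm // sqrrD; have := Re_cauchy_schwarz Su Sv; lra.
Qed.

Lemma snorm0 : snorm b 0 = 0.
Proof. by rewrite /snorm si0l //= sqrtr0. Qed.

Lemma snorm_sum (I : finType) (F : I -> X) : (forall i, S (F i)) ->
  snorm b (\sum_i F i) <= \sum_i snorm b (F i).
Proof.
move=> SF; suff [] : snorm b (\sum_i F i) <= \sum_i snorm b (F i) /\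
    S (\sum_i F i) by [].
elim/big_rec2: _ => [|i x y _ [le_yx Sy]]; first by rewrite snorm0.
split; last exact: linear_subspaceD.
by apply: le_trans (snormD _ _) _ => //; rewrite lerD2l.
Qed.

(** Pythagoras. It serves for best approximation, for Bessel's inequality in the energy, and for
    Galerkin's optimality. *)
Lemma orthogonal_snorm_le x y : S x -> S y -> b x y = 0 ->
  snorm b x <= snorm b (x + y).
Proof.
move=> Sx Sy xy0; have Sxy := linear_subspaceD SS Sx Sy.
rewrite -(ler_pXn2r (n := 2)) ?nnegrE ?snorm_ge0 //.
rewrite [leRHS]sqr_snorm // siDl // !siDr // xy0 (si_hermitian Sb Sx Sy) xy0.
by rewrite conjc0 addr0 add0r ReD -!sqr_snorm // lerDl sqr_ge0.
Qed.

End theory.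
End semi_inner_product.

(** * Spectral and LSSI approximation on one subdomain *)

Section local_problem.
Context {R : realType} {X : lmodType R[i]}.
Variables (W : set X) (p a : X -> X -> R[i]).
Hypotheses (Wp : semi_inner W p) (Wa : semi_inner W a).
Variables (lam : nat -> R) (ephi : nat -> X).
Hypotheses (ephiW : forall j, W (ephi j)) (lam_gt0 : forall j, 0 < lam j)
  (lam_decr : forall j, lam j.+1 <= lam j)
  (ephi_orthonormal : forall j k, p (ephi j) (ephi k) = (j == k)%:R)
  (ephi_eigen : forall j v, W v -> (lam j)%:C * a (ephi j) v = p (ephi j) v)
  (ephi_complete : forall v (e : R), W v -> 0 < e ->
    exists N (c : 'I_N -> R[i]), snorm p (v - \sum_(j < N) c j *: ephi j) < e).
Let WS : linear_subspace W := si_subspace Wp.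

Lemma lam_le j k : (j <= k)%N -> lam k <= lam j.
Proof.
move=> /subnKC <-; elim: (k - j)%N => [|n IH]; first by rewrite addn0.
by rewrite addnS; exact: le_trans IH.
Qed.

Lemma energy_ephi j v : W v -> a (ephi j) v = (lam j)^-1%:C * p (ephi j) v.
Proof.
move=> Wv; rewrite -ephi_eigen // mulrA -rmorphM /= mulVf ?gt_eqF //.
by rewrite rmorph1 mul1r.
Qed.

Lemma p_comb_ephi N (c : 'I_N -> R[i]) (k : 'I_N) :
  p (\sum_(j < N) c j *: ephi j) (ephi k) = c k.
Proof.
rewrite (si_combl Wp) // (bigD1 k) //= ephi_orthonormal eqxx mulr1.
rewrite big1 ?addr0 // => j jk.
by rewrite ephi_orthonormal -(inj_eq val_inj) in jk *;
  rewrite (negbTE jk) mulr0.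
Qed.

Lemma snorm_p_comb N (c : 'I_N -> R[i]) :
  snorm p (\sum_(j < N) c j *: ephi j) ^+ 2 = \sum_j normc (c j) ^+ 2.
Proof.
have Ws : W (\sum_(j < N) c j *: ephi j) by exact: linear_subspace_comb.
rewrite (sqr_snorm Wp) // (si_combr Wp) // Re_sum.
by apply: eq_bigr => j _; rewrite p_comb_ephi mulrC Re_mul_conjc.
Qed.

Lemma snorm_a_comb N (c : 'I_N -> R[i]) :
  snorm a (\sum_(j < N) c j *: ephi j) ^+ 2 =
    \sum_(j < N) (lam j)^-1 * normc (c j) ^+ 2.
Proof.
have Ws : W (\sum_(j < N) c j *: ephi j) by exact: linear_subspace_comb.
rewrite (sqr_snorm Wa) // (si_combl Wa) // Re_sum.
apply: eq_bigr => j _; rewrite energy_ephi // (si_hermitian Wp Ws) //.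
by rewrite p_comb_ephi mulrCA ReZ Re_mul_conjc.
Qed.

(** Completeness holds in the norm of [p] only. The Fourier sum [s] is [p]-close to [r], its energy
    is at most that of [r], and for finite sums the bound is read off the coefficients; then [e]
    tends to 0. *)
Lemma rayleigh L r : W r -> (forall j, (j < L)%N -> p r (ephi j) = 0) ->
  snorm p r <= Num.sqrt (lam L) * snorm a r.
Proof.
move=> Wr r_orth; apply/ler_addgt0Pr => e e0.
have [N [d rd]] := ephi_complete Wr e0.
pose s := \sum_(j < N) p r (ephi j) *: ephi j.
have Ws : W s by exact: linear_subspace_comb.
have Wrs : W (r - s) by exact: linear_subspaceB.
have rs_orth (c : 'I_N -> R[i]) : p (r - s) (\sum_(j < N) c j *: ephi j) = 0.
  rewrite (si_combr Wp) // big1 // => k _.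
  by rewrite (siBl Wp) // p_comb_ephi subrr mulr0.
(* The coefficients [d] from completeness are arbitrary; the Fourier coefficients do at least as
   well, since [r - s] is orthogonal to all the combinations. *)
have rs_e : snorm p (r - s) < e.
  apply: le_lt_trans rd.
  have -> : r - \sum_(j < N) d j *: ephi j =
      (r - s) + \sum_(j < N) (p r (ephi j) - d j) *: ephi j.
    under [in RHS]eq_bigr do rewrite scalerBl.
    by rewrite sumrB addrA subrK.
  apply: (orthogonal_snorm_le Wp) => //; exact: linear_subspace_comb.
(* Bessel's inequality for the energy: [s] and [r - s] are orthogonal for [a] as well. *)
have s_r : snorm a s <= snorm a r.
  rewrite -[in leRHS](subrKC s r); apply: (orthogonal_snorm_le Wa) => //.
  rewrite (si_combl Wa) // big1 // => j _; rewrite energy_ephi //.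
  by rewrite (siBr Wp) // (si_hermitian Wp Ws) // p_comb_ephi
    -(si_hermitian Wp) // subrr !mulr0.
have s_s : snorm p s <= Num.sqrt (lam L) * snorm a s.
  rewrite -(ler_pXn2r (n := 2)) ?nnegrE ?mulr_ge0 ?snorm_ge0 ?sqrtr_ge0 //.
  rewrite exprMn [Num.sqrt (lam L) ^+ 2]sqr_sqrtr ?(ltW (lam_gt0 _)) //.
  rewrite (snorm_p_comb _ : snorm p s ^+ 2 = _).
  rewrite (snorm_a_comb _ : snorm a s ^+ 2 = _).
  rewrite mulr_sumr; apply: ler_sum => j _.
  (* Coefficients of index below [L] vanish by assumption; from [L] on, [lam j <= lam L]. *)
  have [jL|Lj] := ltnP j L; first by rewrite r_orth // normc0 expr0n !mulr0.
  by rewrite mulrA ler_peMl ?sqr_ge0 // ler_pdivlMr // mul1r lam_le.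
rewrite -[r in leLHS](subrK s) [leRHS]addrC.
apply: le_trans (snormD Wp Wrs Ws) _.
apply: lerD (ltW rs_e) _; apply: le_trans s_s _.
by rewrite ler_wpM2l ?sqrtr_ge0.
Qed.

(** With [L = 0], Rayleigh's bound carries no orthogonality condition: it is a Poincare
    inequality. *)
Lemma snorm_p_eq0 t : W t -> snorm a t = 0 -> snorm p t = 0.
Proof.
move=> Wt t0; apply/eqP; rewrite eq_le snorm_ge0 andbT.
by have := @rayleigh 0 t Wt; rewrite t0 mulr0; apply.
Qed.

(** The residual satisfies [a r r = p g r], being energy-orthogonal to the eigenfunctions
    subtracted; Cauchy-Schwarz and Rayleigh's bound conclude. [H] is the ambient space: [g] is the
    operator value of [v] and need not lie in [W]. *)
Lemma projection_error H L v g : semi_inner H p -> W `<=` H -> W v -> H g ->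
  (forall w, W w -> a v w = p g w) ->
  snorm a (v - \sum_(j < L) p v (ephi j) *: ephi j) <=
    Num.sqrt (lam L) * snorm p g.
Proof.
move=> Hp WH Wv Hg vg; set s := \sum_(j < L) _; set r := v - s.
have Ws : W s by exact: linear_subspace_comb.
have Wr : W r by exact: linear_subspaceB.
have r_orth j : (j < L)%N -> p r (ephi j) = 0.
  move=> jL; rewrite (siBl Wp) //.
  by rewrite (p_comb_ephi (fun k : 'I_L => p v (ephi k)) (Ordinal jL)) subrr.
have rr : a r r = p g r.
  rewrite [LHS](siBl Wa) // vg // (si_combl Wa) // big1 ?subr0 // => j _.
  by rewrite energy_ephi // (si_hermitian Wp Wr) // r_orth // conjc0 !mulr0.
have : 0 <= snorm a r by exact: snorm_ge0.
rewrite le_eqVlt => /predU1P[<-|r0].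
  by rewrite mulr_ge0 ?sqrtr_ge0 ?snorm_ge0.
rewrite -(ler_pM2r r0) -expr2 (sqr_snorm Wa) // rr mulrAC mulrC.
apply: le_trans (Re_cauchy_schwarz Hp Hg (WH _ Wr)) _.
by rewrite ler_wpM2l ?snorm_ge0 ?rayleigh.
Qed.

(** * The LSSI iteration and its rate of convergence *)

Variables (L : nat) (phi : nat -> 'I_L -> X).
Hypotheses (L_gt0 : (0 < L)%N) (phiW : forall n k, W (phi n k))
  (phi_step : forall n k, exists mu : 'I_L -> R[i],
    (forall v, W v -> a (phi n.+1 k) v + \sum_j mu j * p (phi n j) v = 0) /\
    forall j, p (phi n j) (phi n.+1 k) = (j == k)%:R).

(* By biorthogonality, testing the saddle point problem with the new basis
   functions shows that the multipliers are, up to sign, their energy Gram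
   matrix. *)
Lemma lssi_energy n k v : W v -> a (phi n.+1 k) v =
  \sum_l a (phi n.+1 k) (phi n.+1 l) * p (phi n l) v.
Proof.
move=> Wv; have [mu [mu_a mu_p]] := phi_step n k.
have {}mu_p j l : p (phi n j) (phi n.+1 l) = (j == l)%:R.
  by have [mu' [_ ->]] := phi_step n l.
have mu_gram l : mu l = - a (phi n.+1 k) (phi n.+1 l).
  apply/eqP; rewrite -addr_eq0 addrC -(mu_a (phi n.+1 l)) //.
  rewrite (bigD1 l) //= mu_p eqxx mulr1 big1 ?addr0 // => j jl.
  by rewrite mu_p (negbTE jl) mulr0.
have /eqP := mu_a v Wv; rewrite addr_eq0 => /eqP ->.
by rewrite -sumrN; apply: eq_bigr => l _; rewrite mu_gram mulNr opprK.
Qed.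

(** The exact inverse maps each LSSI space into the next. In coordinates, applying the operator to
    the new basis is multiplication by its energy Gram matrix [A], so [c'] is [c] times the inverse
    of [A]. *)
Lemma lssi_inverse n (c : 'I_L -> R[i]) : exists c' : 'I_L -> R[i],
  forall v, W v ->
    a (\sum_k c' k *: phi n.+1 k) v = p (\sum_k c k *: phi n k) v.
Proof.
pose A := \matrix_(k, l) a (phi n.+1 k) (phi n.+1 l).
have energyE (x : 'rV_L) v : W v ->
    a (\sum_k x 0 k *: phi n.+1 k) v = \sum_l (x *m A) 0 l * p (phi n l) v.
  move=> Wv; rewrite (si_combl Wa) //.
  under eq_bigr do rewrite lssi_energy // mulr_sumr.
  rewrite exchange_big; apply: eq_bigr => l _ /=; rewrite mxE mulr_suml.
  by apply: eq_bigr => k _; rewrite mxE mulrA.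
(* A kernel vector gives a function [t] of zero energy, hence of zero [p]-norm; biorthogonality
   reads each coefficient off its product with the old basis. *)
have A_unit : A \in unitmx.
  rewrite -row_free_unit; apply: inj_row_free => x xA.
  set t := \sum_k x 0 k *: phi n.+1 k.
  have Wt : W t by exact: linear_subspace_comb.
  have t0 : snorm a t = 0.
    rewrite /snorm energyE // xA big1 /= ?sqrtr0 // => l _.
    by rewrite mxE mul0r.
  have {}t0 := snorm_p_eq0 Wt t0.
  apply/rowP => l; rewrite mxE.
  have : p (phi n l) t = 0.
    apply: eq0_normc; apply/eqP; rewrite eq_le normc_ge0 andbT.
    by have := cauchy_schwarz Wp (phiW n l) Wt; rewrite t0 mulr0.
  rewrite (si_combr Wp) // (bigD1 l) //= big1 ?addr0.
    have [mu' [_ ->]] := phi_step n l.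
    by rewrite eqxx mulr1 => /eqP; rewrite conjc_eq0 => /eqP.
  move=> k kl; have [mu' [_ ->]] := phi_step n k.
  by rewrite eq_sym (negbTE kl) mulr0.
exists (fun k => ((\row_l c l) *m invmx A) 0 k) => v Wv.
rewrite energyE // mulmxKV // (si_combl Wp) //.
by apply: eq_bigr => l _; rewrite mxE.
Qed.

(** The orthogonality is carried through the induction because Rayleigh's bound rests on it at each
    step. *)
Lemma lssi_eigen_error j (c0 : 'I_L -> R[i])
    (e0 := \sum_k c0 k *: phi 0%N k - ephi j) :
  (forall k, (k < L)%N -> p e0 (ephi k) = 0) -> forall n,
  exists c : 'I_L -> R[i],
    let e := \sum_k c k *: phi n k - ((lam j) ^+ n)%:C *: ephi j in
    (forall k, (k < L)%N -> p e (ephi k) = 0) /\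
    snorm a e <= lam L ^+ n * snorm a e0.
Proof.
move=> e0_orth; elim=> [|n [c /= [e_orth e_le]]].
  by exists c0; rewrite /= !expr0 scale1r mul1r.
set e := _ - _ in e_orth e_le.
have [c' c'E] := lssi_inverse n c; exists c' => /=; set e' := _ - _.
have We : W e by apply: linear_subspaceB => //;
  [exact: linear_subspace_comb|exact: linear_subspaceZ].
have We' : W e' by apply: linear_subspaceB => //;
  [exact: linear_subspace_comb|exact: linear_subspaceZ].
(* The inverse sends [ephi j] to [lam j] times itself, so the error obeys the same recursion as the
   basis. *)
have e'E v : W v -> a e' v = p e v.
  move=> Wv; rewrite (siBl Wa) ?(siBl Wp) //;
    [|exact: linear_subspace_comb|exact: linear_subspaceZ
     |exact: linear_subspace_comb|exact: linear_subspaceZ].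
  rewrite c'E // (siZl Wa) // (siZl Wp) // -ephi_eigen // exprSr rmorphM /=.
  by rewrite mulrA.
(* The inverse is self-adjoint and [ephi k] is an eigenfunction: this product is [lam k] times that
   of [e] with [ephi k]. *)
have e'_orth k : (k < L)%N -> p e' (ephi k) = 0.
  move=> kL; rewrite (si_hermitian Wp (ephiW k) We') -ephi_eigen //.
  by rewrite (si_hermitian Wa We') // e'E // e_orth // !(conjc0, mulr0).
split=> //.
have : 0 <= snorm a e' by exact: snorm_ge0.
rewrite le_eqVlt => /predU1P[<-|e'0].
  by rewrite mulr_ge0 ?snorm_ge0 // exprn_ge0 // ltW.
apply: le_trans (_ : lam L * snorm a e <= _); last first.
  by rewrite exprS -mulrA ler_wpM2l // ltW.
rewrite -(ler_pM2r e'0) -expr2 (sqr_snorm Wa) // e'E //.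
apply: le_trans (Re_cauchy_schwarz Wp We We') _.
(* Rayleigh's bound applies to both [e] and [e'], and each contributes one square root of
   [lam L]. *)
rewrite -[lam L](@sqr_sqrtr _ (lam L)) ?(ltW (lam_gt0 _)) // expr2.
by rewrite -mulrA mulrACA ler_pM ?snorm_ge0 ?rayleigh.
Qed.

(** Weak form of [P s = ephi j], where [s] has the coefficients [c0]. *)
Hypothesis initial : forall j, (j < L)%N -> exists c0 : 'I_L -> R[i],
  forall k, (k < L)%N -> p (\sum_l c0 l *: phi 0%N l - ephi j) (ephi k) = 0.

(** Indices start at 0, so [lam L] and [lam L.-1] are the eigenvalues numbered [L + 1] and [L]. The
    error splits at the spectral projection [q] of [v]: [v - q] gives the first term and [q - w] the
    second. *)
Lemma local_approximation H : semi_inner H p -> W `<=` H ->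
  exists2 C : R, 0 <= C & forall v g n, W v -> H g ->
  (forall w, W w -> a v w = p g w) -> exists c : 'I_L -> R[i],
    snorm a (v - \sum_k c k *: phi n k) <=
      Num.sqrt (lam L) * snorm p g
      + C * (lam L / lam L.-1) ^+ n * snorm p v.
Proof.
move=> Hp WH.
have /choice[c0 c0E] (j : 'I_L) : exists c0 : 'I_L -> R[i],
    forall k, (k < L)%N -> p (\sum_l c0 l *: phi 0%N l - ephi j) (ephi k) = 0.
  exact: initial.
pose e0 j := \sum_l c0 j l *: phi 0%N l - ephi j.
(* The energies of the initial errors, which depend on neither [v], [g] nor [n]. *)
exists (\sum_j snorm a (e0 j)).
  by apply: sumr_ge0 => j _; exact: snorm_ge0.
move=> v g n Wv Hg vg.
have /choice[c cE] (j : 'I_L) : exists c : 'I_L -> R[i],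
    snorm a (\sum_k c k *: phi n k - ((lam j) ^+ n)%:C *: ephi j) <=
    lam L ^+ n * snorm a (e0 j).
  by have [c [_ ?]] := lssi_eigen_error (c0E j) n; exists c.
pose x j := p v (ephi j).
(* The power of [lam j] is divided out, so that [y j *: s j] approximates [x j *: ephi j]. *)
pose y (j : 'I_L) := x j * ((lam j) ^- n)%:C.
pose s j := \sum_k c j k *: phi n k.
have Ws j : W (s j) by exact: linear_subspace_comb.
pose w := \sum_j y j *: s j.
pose q := \sum_(j < L) x j *: ephi j.
have Ww : W w by exact: linear_subspace_comb.
have Wq : W q by exact: linear_subspace_comb.
have wE : w = \sum_k (\sum_j y j * c j k) *: phi n k.
  under [RHS]eq_bigr do rewrite scaler_suml.
  rewrite exchange_big; apply: eq_bigr => j _ /=; rewrite scaler_sumr.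
  by apply: eq_bigr => k _; rewrite scalerA.
exists (fun k => \sum_j y j * c j k); rewrite -wE.
have -> : v - w = (v - q) + (q - w) by rewrite addrA subrK.
apply: le_trans (snormD Wa _ _) _; [exact: linear_subspaceB..|].
apply: lerD; first exact: projection_error Hp WH Wv Hg vg.
have -> : q - w = \sum_j (- y j) *: (s j - ((lam j) ^+ n)%:C *: ephi j).
  rewrite -sumrB; apply: eq_bigr => j _.
  rewrite scalerBr scalerA mulNr !scaleNr opprK [RHS]addrC; congr (_ *: _ - _).
  by rewrite /y -mulrA -rmorphM /= mulVf ?expf_neq0 ?gt_eqF // rmorph1 mulr1.
have Wsl j : W (s j - ((lam j) ^+ n)%:C *: ephi j).
  by apply: linear_subspaceB => //; exact: linear_subspaceZ.
apply: le_trans (snorm_sum Wa _) _ => [j|]; first exact: linear_subspaceZ.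
rewrite -mulrA mulr_suml; apply: ler_sum => j _.
rewrite (snormZ Wa) // normcN normcM normc_real.
have lamj0 : 0 < lam j ^+ n by rewrite exprn_gt0.
have xv : normc (x j) <= snorm p v.
  have := cauchy_schwarz Wp Wv (ephiW j).
  by rewrite /snorm [X in _ * Num.sqrt (complex.Re X)]ephi_orthonormal eqxx /=
    sqrtr1 mulr1.
rewrite ger0_norm ?invr_ge0 ?(ltW lamj0) //.
apply: le_trans (_ : snorm p v * (lam j ^+ n)^-1 *
    (lam L ^+ n * snorm a (e0 j)) <= _).
  apply: ler_pM; last exact: cE.
  - by rewrite mulr_ge0 ?normc_ge0 // invr_ge0 ltW.
  - exact: snorm_ge0.
  - by rewrite ler_wpM2r // invr_ge0 ltW.
have -> : snorm p v / lam j ^+ n * (lam L ^+ n * snorm a (e0 j)) =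
    snorm a (e0 j) * (lam L ^+ n / lam j ^+ n * snorm p v) by ring.
rewrite ler_wpM2l ?snorm_ge0 // ler_wpM2r ?snorm_ge0 // expr_div_n.
rewrite ler_wpM2l ?exprn_ge0 ?(ltW (lam_gt0 _)) //.
(* The ratio is worst for the last index: [j <= L.-1] gives [lam L.-1 <= lam j]. *)
rewrite lef_pV2 ?posrE ?exprn_gt0 //.
rewrite lerXn2r ?nnegrE ?(ltW (lam_gt0 _)) // lam_le //.
by rewrite -ltnS prednK.
Qed.

End local_problem.

(** * The L^2 inner product *)

Section measurability.
Context {R : realType}.
Variable d : nat.
Local Notation E := 'rV[R]_d.

(** The sigma-algebra is generated by cylinders. Balls of row vectors being cubes, an open set is a
    countable union of boxes with rational corners. *)
Lemma open_measurable_rV (A : set E) : open A -> measurable A.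
Proof.
move=> oA.
pose box (ab : 'rV[rat]_d * 'rV[rat]_d) : set E := [set y : E | forall i,
  [set` `]ratr (ab.1 0 i), ratr (ab.2 0 i)[] (y 0 i)].
have mbox ab : measurable (box ab).
  apply: (@measurable_rV_box _ _
    (fun i => [set` `]ratr (ab.1 0 i), ratr (ab.2 0 i)[])) => i.
  exact: measurable_itv.
(* Boxes that leave [A] are replaced by [set0], so that the index runs over a whole countable
   type. *)
have -> : A = \bigcup_ab (if `[< box ab `<=` A >] then box ab else set0).
  apply/seteqP; split=> [x Ax|x [ab _]]; last first.
    by case: ifPn => // /asboolP boxA /boxA.
  have /nbhs_ballP[e /= e0 eA] : nbhs x A by exact: open_nbhs_nbhs.
  have /choice[a aP] (i : 'I_d) : exists q : rat,
      ratr q \in `]x 0 i - e, x 0 i[.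
    by apply: rat_in_itvoo; rewrite gtrBl.
  have /choice[b bP] (i : 'I_d) : exists q : rat,
      ratr q \in `]x 0 i, x 0 i + e[.
    by apply: rat_in_itvoo; rewrite ltrDl.
  exists (\row_i a i, \row_i b i) => //; rewrite asboolT.
    move=> i /=; rewrite !mxE in_itv /=.
    have := aP i; have := bP i; rewrite !in_itv /=.
    by move=> /andP[-> _] /andP[_ ->].
  move=> y /= yab; apply: eA; split=> // i j; rewrite (ord1 i).
  have := yab j; rewrite /= in_itv /= !mxE => /andP[ay yb].
  have := aP j; have := bP j; rewrite !in_itv /= => /andP[_ be] /andP[ae _].
  rewrite /ball /= ltr_distl; lra.
apply: countable_bigcupT_measurable; first exact: countableP.
by move=> ab; case: ifP.
Qed.

End measurability.

Section L2_theory.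
Context {R : realType}.
Variables (d : nat) (D : set 'rV[R]_d).
Hypothesis mD : measurable D.
Local Notation E := 'rV[R]_d.
Local Notation fn := (E -> R[i]).
Local Notation mu := (rV_lebesgue d).
Local Notation Re := (@complex.Re R).
Local Notation Im := (@complex.Im R).
Implicit Types (f g h u v w : fn) (c : R[i]).

Let sq f : E -> R := fun x => Re (f x) ^+ 2 + Im (f x) ^+ 2.

Let sq_ge0 f x : 0 <= sq f x.
Proof. by rewrite addr_ge0 ?sqr_ge0. Qed.

(* In the definition of [ip], [^*] parses as the conjugation [Num.conj] of
   closed fields, whose theory ignores real and imaginary parts. *)
Lemma ipE f g : ip D f g = cintegral D (fun x => f x * conjc (g x)).
Proof. by []. Qed.

Lemma cmeasurableM f g : cmeasurable D f -> cmeasurable D g ->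
  cmeasurable D (fun x => f x * g x).
Proof.
move=> [fr fi] [gr gi]; split.
- rewrite (_ : (fun _ => _) =
      ((Re \o f) \* (Re \o g)) \- ((Im \o f) \* (Im \o g))).
    by apply: measurable_funB; exact: measurable_funM.
  by apply/funext => x /=; case: (f x) (g x) => ? ? [].
- rewrite (_ : (fun _ => _) =
      ((Re \o f) \* (Im \o g)) \+ ((Im \o f) \* (Re \o g))).
    by apply: measurable_funD; exact: measurable_funM.
  by apply/funext => x /=; case: (f x) (g x) => ? ? [].
Qed.

Lemma cmeasurableD f g : cmeasurable D f -> cmeasurable D g ->
  cmeasurable D (fun x => f x + g x).
Proof.
move=> [fr fi] [gr gi]; split.
- rewrite (_ : (fun _ => _) = (Re \o f) \+ (Re \o g)).
    exact: measurable_funD.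
  by apply/funext => x /=; case: (f x) (g x) => ? ? [].
- rewrite (_ : (fun _ => _) = (Im \o f) \+ (Im \o g)).
    exact: measurable_funD.
  by apply/funext => x /=; case: (f x) (g x) => ? ? [].
Qed.

Lemma cmeasurable_cst c : cmeasurable D (fun=> c).
Proof. by split; exact: measurable_cst. Qed.

Lemma cmeasurable_conjc f : cmeasurable D f ->
  cmeasurable D (fun x => conjc (f x)).
Proof.
move=> [fr fi]; split.
- rewrite (_ : (fun _ => _) = Re \o f) //.
  by apply/funext => x /=; case: (f x).
- rewrite (_ : (fun _ => _) = \- (Im \o f)); first exact: measurable_funN.
  by apply/funext => x /=; case: (f x).
Qed.

Lemma L2P f : L2 D f <-> cmeasurable D f /\ mu.-integrable D (EFin \o sq f).
Proof.
have normE : (fun x => `|(EFin \o sq f) x|%E) = EFin \o sq f.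
  by apply/funext => x /=; rewrite ger0_norm.
split=> [[mf foo]|[mf /integrableP[_]]].
  split=> //; apply/integrableP; split; last by rewrite normE.
  case: mf => fr fi; apply/measurable_EFinP.
  by apply: measurable_funD; exact: measurable_funX.
by rewrite normE; split.
Qed.

(** Both parts of the product are dominated by the sum of the squared moduli; the squares listed in
    the proof yield this by [nra]. *)
Lemma cintegrable_L2 f g : L2 D f -> L2 D g ->
  cintegrable D (fun x => f x * conjc (g x)).
Proof.
move=> /L2P[mf fi] /L2P[mg gi].
have [mr mi] := cmeasurableM mf (cmeasurable_conjc mg).
have fgi := integrableD mD fi gi.
split; apply: (le_integrable mD _ _ fgi); try exact/measurable_EFinP;
  move=> x _; rewrite /= lee_fin [leRHS]ger0_norm /sq ?addr_ge0 ?sqr_ge0 //;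
  case: (f x) (g x) => a b [a' b'] /=; rewrite ler_norml;
  have := sqr_ge0 (a + a'); have := sqr_ge0 (a - a');
  have := sqr_ge0 (b + b'); have := sqr_ge0 (b - b');
  have := sqr_ge0 (a + b'); have := sqr_ge0 (a - b');
  have := sqr_ge0 (b + a'); have := sqr_ge0 (b - a'); nra.
Qed.

Lemma cintegral_linear c f g : cintegrable D f -> cintegrable D g ->
  cintegral D (fun x => c * f x + g x) = c * cintegral D f + cintegral D g.
Proof.
move=> [fr fi] [gr gi]; case: c => a b.
have intZ (k : R) (s : E -> R) : mu.-integrable D (EFin \o s) ->
  mu.-integrable D (EFin \o (fun x => k * s x)) by exact: integrableZl.
have intD (s t : E -> R) : mu.-integrable D (EFin \o s) ->
  mu.-integrable D (EFin \o t) ->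
  mu.-integrable D (EFin \o (fun x => s x + t x)) by exact: integrableD.
rewrite /cintegral; apply/eqP; rewrite eq_complex /=; apply/andP; split.
- rewrite (@eq_Rintegral _ _ _ _ _
    (fun x => (a * Re (f x) + (- b) * Im (f x)) + Re (g x))); last first.
    by move=> x _ /=; case: (f x) (g x) => ? ? [? ?] /=; rewrite mulNr.
  rewrite RintegralD ?RintegralD ?RintegralZl ?mulNr //;
    do ?[exact: intZ | apply: intD => //; exact: intZ].
- rewrite (@eq_Rintegral _ _ _ _ _
    (fun x => (a * Im (f x) + b * Re (f x)) + Im (g x))); last first.
    by move=> x _ /=; case: (f x) (g x) => ? ? [? ?].
  rewrite RintegralD ?RintegralD ?RintegralZl //;
    do ?[exact: intZ | apply: intD => //; exact: intZ].
Qed.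

Lemma L2_subspace : linear_subspace (L2 D).
Proof.
split=> [|c u v /L2P[mu_ ui] /L2P[mv vi]]; apply/L2P; split.
- exact: cmeasurable_cst.
- rewrite (_ : _ \o _ = fun=> 0%E); first exact: integrable0.
  by apply/funext => x; rewrite /= /sq /= expr0n addr0.
- apply: cmeasurableD => //; apply: cmeasurableM => //;
    exact: cmeasurable_cst.
have [mr mi] : cmeasurable D (c *: u + v).
  apply: cmeasurableD => //; apply: cmeasurableM => //;
    exact: cmeasurable_cst.
(* Domination of [|c u + v|^2] by [2 |c u|^2 + 2 |v|^2]; the squares below are those of the two
   parts of [c u - v]. *)
have ci := integrableD mD (integrableZl mD (2 * normc c ^+ 2) ui)
  (integrableZl mD 2 vi).
apply: (le_integrable mD _ _ ci).
  by apply/measurable_EFinP; apply: measurable_funD; exact: measurable_funX.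
move=> x _; rewrite /= lee_fin !ger0_norm //; last first.
  by rewrite addr_ge0 // mulr_ge0 ?sq_ge0 // mulr_ge0 ?sqr_ge0.
rewrite -Re_mul_conjc /sq (_ : (c *: u + v) x = c * u x + v x) //.
case: c {mr mi ci} (u x) (v x) => a b [r s] [t w] /=.
have := sqr_ge0 (a * r - b * s - t); have := sqr_ge0 (a * s + b * r - w).
nra.
Qed.

Lemma ip_semi_inner : semi_inner (L2 D) (ip D).
Proof.
split.
- exact: L2_subspace.
- move=> c u v w Du Dv Dw; rewrite !ipE -cintegral_linear //;
    [|exact: cintegrable_L2..].
  by congr cintegral; apply/funext => x; rewrite mulrDl -mulrA.
- move=> u v Du Dv; rewrite !ipE /cintegral /=; congr Complex.
    by apply: eq_Rintegral => x _; case: (u x) (v x) => ? ? [? ?] /=; ring.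
  rewrite -mulN1r -RintegralZl //; last by have [] := cintegrable_L2 Du Dv.
  by apply: eq_Rintegral => x _; case: (u x) (v x) => ? ? [? ?] /=; ring.
- move=> v Dv; rewrite ipE lecE /=; apply/andP; split.
    rewrite (@eq_Rintegral _ _ _ _ _ (fun=> 0)).
      by rewrite Rintegral_cst // mul0r.
    by move=> x _; case: (v x) => ? ? /=; ring.
  apply: Rintegral_ge0 => x _; rewrite Re_mul_conjc; exact: sqr_ge0.
Qed.

Lemma aeq_refl f : aeq D f f.
Proof. exact: aeW. Qed.

Lemma aeq_sym f g : aeq D f g -> aeq D g f.
Proof. by apply: filterS => x fg Dx; rewrite fg. Qed.

Lemma aeq_trans f g h : aeq D f g -> aeq D g h -> aeq D f h.
Proof. by apply: filterS2 => x fg gh Dx; rewrite fg // gh. Qed.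

Lemma aeq_sum (I : finType) (f g : I -> fn) :
  (forall i, aeq D (f i) (g i)) -> aeq D (\sum_i f i) (\sum_i g i).
Proof.
move=> fg; elim/big_ind2: _ => //; first exact: aeq_refl.
move=> u u' v v'; apply: filterS2 => x uu' vv' Dx.
by rewrite /GRing.add /= uu' // vv'.
Qed.

Lemma cintegral_aeq f g : cmeasurable D f -> cmeasurable D g -> aeq D f g ->
  cintegral D f = cintegral D g.
Proof.
move=> [fr fi] [gr gi] fg; congr Complex; congr fine;
  apply: ae_eq_integral => //; try exact/measurable_EFinP;
  by move: fg; apply: filterS => x fg Dx; rewrite fg.
Qed.

Lemma ip_aeq u u' v : L2 D u -> L2 D u' -> L2 D v -> aeq D u u' ->
  ip D u v = ip D u' v.
Proof.
move=> [mu_ _] [mu' _] [mv _] uu'; rewrite !ipE; apply: cintegral_aeq.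
- by apply: cmeasurableM => //; exact: cmeasurable_conjc.
- by apply: cmeasurableM => //; exact: cmeasurable_conjc.
- by move: uu'; apply: filterS => x uu' Dx; rewrite uu'.
Qed.

Lemma L2_restrict (D' : set E) f : measurable D' -> D' `<=` D ->
  L2 D f -> L2 D' f.
Proof.
move=> mD' D'D [[fr fi] foo]; split.
  by split; exact: (measurable_funS mD D'D).
apply: le_lt_trans foo; apply: ge0_subset_integral => //.
- by apply/measurable_EFinP; apply: measurable_funD; exact: measurable_funX.
- by move=> x _; rewrite lee_fin addr_ge0 ?sqr_ge0.
Qed.

(** Local problems integrate over a subdomain and the global one over the whole domain; the two
    products agree against test functions supported on the subdomain. *)
Lemma ip_restrict (D' : set E) f v : measurable D' -> D' `<=` D ->
  L2 D f -> L2 D v -> aeq (D `\` D') v (fun=> 0) -> ip D' f v = ip D f v.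
Proof.
move=> mD' D'D [mf _] [mv _] v0; rewrite !ipE.
have [mr mi] := cmeasurableM mf (cmeasurable_conjc mv).
have restrict (s : E -> R) : measurable_fun D s ->
    {ae mu, forall x, D x -> ~ D' x -> s x = 0} ->
    Rintegral mu D' s = Rintegral mu D s.
  move=> ms s0; rewrite -[D' in LHS](setIidr D'D) Rintegral_mkcondr.
  congr fine; apply: ae_eq_integral => //.
  - apply/measurable_EFinP/(measurable_restrict _ mD' mD).
    exact: measurable_funS ms.
  - exact/measurable_EFinP.
  - move: s0; apply: filterS => x s0 Dx; congr EFin; rewrite patchE.
    case: ifPn => // /negP D'x; rewrite s0 // => D'x'.
    by apply: D'x; rewrite inE.
by congr Complex; apply: restrict => //;
  move: v0; apply: filterS => x v0 Dx D'x;
  rewrite v0 // rmorph0 mulr0.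
Qed.

Lemma L2norm_mul_le (chi : fn) (M : R) u : 0 <= M ->
  (forall x, D x -> `|chi x| <= M%:C) ->
  L2 D u -> L2 D (fun x => chi x * u x) ->
  L2norm D (fun x => chi x * u x) <= M * L2norm D u.
Proof.
move=> M0 chiM Du Dcu.
rewrite -(ler_pXn2r (n := 2)) ?nnegrE ?mulr_ge0 ?sqrtr_ge0 // exprMn.
rewrite !(sqr_snorm ip_semi_inner) // !ipE /=.
have [ui _] := cintegrable_L2 Du Du.
have [cui _] := cintegrable_L2 Dcu Dcu.
rewrite -RintegralZl //; apply: le_Rintegral => //.
  exact: (integrableZl mD (M ^+ 2) ui).
move=> x Dx; rewrite !Re_mul_conjc normcM exprMn ler_wpM2r ?sqr_ge0 //.
by rewrite lerXn2r ?nnegrE ?normc_ge0 // -lecR; exact: chiM.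
Qed.

End L2_theory.

(** * Galerkin approximation *)

Section global_problem.
Context {R : realType}.
Variables (d : nat) (Omega : set 'rV[R]_d) (m : nat) (GammaD : set 'rV[R]_d).
Local Notation fn := ('rV[R]_d -> R[i]).
Variables (V : set fn) (a : fn -> fn -> R[i]).
Hypotheses (oOmega : open Omega) (hV : sobolev_space Omega m GammaD V)
  (ha : pde_form Omega m V a).
Let mOmega : measurable Omega := open_measurable_rV oOmega.
Let Hp := ip_semi_inner mOmega.

Lemma space_L2 : V `<=` L2 Omega.
Proof. by move=> v /(space_sobolev hV)[]. Qed.

Lemma space_subspace : linear_subspace V.
Proof. exact: space_linear hV. Qed.

Lemma energy_semi_inner : semi_inner V a.
Proof.
split.
- exact: space_subspace.
- by move=> c u v w; exact: form_linear ha _ _ _ _.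
- by move=> u v; exact: form_hermitian ha _ _.
move=> v Vv.
(* Strict positivity is available off null functions; on those, [a v v = a 0 v = 0]. *)
have [v0|/(form_positive ha Vv)/ltW//] := pselect (aeq Omega v (fun=> 0)).
have V0 : V (fun=> 0) by exact: (proj1 space_subspace).
rewrite (form_aeq ha Vv V0 Vv v0).
have /eqP := form_linear ha 1 V0 V0 Vv.
rewrite (_ : (fun x => _) = fun=> 0); last first.
  by apply/funext => x; rewrite mulr0 addr0.
by rewrite mul1r -subr_eq0 opprD addrA subrr add0r oppr_eq0 => /eqP ->.
Qed.

Lemma local_subspace (omega : set 'rV[R]_d) :
  linear_subspace (local_space Omega V omega).
Proof.
have [V0 VL] := space_subspace.
split=> [|c u v [Vu u0] [Vv v0]].
  by split=> //; exact: aeq_refl.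
split; first exact: VL.
move: u0 v0; apply: filterS2 => x u0 v0 Dx.
by rewrite (_ : (c *: u + v) x = c * u x + v x) // u0 // v0 // mulr0 addr0.
Qed.

Lemma comb_fctE N (c : 'I_N -> R[i]) (F : 'I_N -> fn) :
  \sum_j c j *: F j = (fun x => \sum_j c j * F j x).
Proof. by apply/funext => x; rewrite fct_sumE. Qed.

(** * One subdomain as an instance of the abstract local problem *)

Section local.
Variables (omega : set 'rV[R]_d) (lam : nat -> R) (ephi : nat -> fn).
Variables (L : nat) (phi : nat -> 'I_L -> fn).
Hypotheses (o_omega : open omega) (omega_sub : omega `<=` Omega)
  (hlocal : well_posed Omega a (local_space Omega V omega) omega)
  (heigen : eigenpairs Omega a V omega lam ephi)
  (L_gt0 : (0 < L)%N) (hphi : lssi_basis Omega a V omega phi)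
  (hinit : unique_preimages Omega L ephi (span_of Omega (phi 0%N))).
Let W := local_space Omega V omega.
Let WV : W `<=` V. Proof. by move=> v []. Qed.
Let WH : W `<=` L2 Omega. Proof. by move=> v /WV/space_L2. Qed.

Lemma eigen_variational j v : W v ->
  (lam j)%:C * a (ephi j) v = ip Omega (ephi j) v.
Proof.
move=> Wv; have We := eigen_local heigen j.
have [He Hv] : L2 Omega (ephi j) /\ L2 Omega v by split; exact: WH.
have mo := open_measurable_rV o_omega.
rewrite -(ip_restrict mOmega mo omega_sub He Hv); last by case: Wv.
(* Well-posedness makes [solution_op] return an actual solution and not its default value. *)
have [u usol _] := hlocal (L2_restrict mOmega mo omega_sub He).
have [Ws <-//] :
    is_solution a W omega (ephi j) (solution_op a W omega (ephi j)).
  exact: (xgetI (fun=> 0) usol).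
rewrite (form_aeq ha (WV Ws) _ (WV Wv) (eigen_eq heigen j)).
  by rewrite -(siZl energy_semi_inner) //; exact: WV.
exact: linear_subspaceZ space_subspace (WV We).
Qed.

(** For [k < L], a function and its spectral projection have the same product with [ephi k], and the
    projection of [s] is [ephi j] almost everywhere. *)
Lemma initial_approximation j : (j < L)%N -> exists c0 : 'I_L -> R[i],
  forall k, (k < L)%N ->
    ip Omega (\sum_l c0 l *: phi 0%N l - ephi j) (ephi k) = 0.
Proof.
move=> jL; have [s [[Hs [c0 sE]] sP] _] := hinit jL.
exists c0 => k kL.
have He l : L2 Omega (ephi l) by apply: WH; exact: eigen_local heigen l.
have Hc : L2 Omega (\sum_l c0 l *: phi 0%N l).
  apply: linear_subspace_comb (si_subspace Hp) _ => l.
  by apply: WH; exact: lssi_local hphi _ _.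
rewrite (siBl Hp) //.
rewrite -(ip_aeq mOmega Hs Hc); [|exact: He|by rewrite comb_fctE].
rewrite -(ip_aeq mOmega _ (He j) (He k) sP); last first.
  rewrite /spectral_projector -comb_fctE.
  exact: linear_subspace_comb (si_subspace Hp) _.
rewrite /spectral_projector -comb_fctE.
rewrite (p_comb_ephi (semi_inner_sub Hp (local_subspace omega) WH)
  (eigen_local heigen) (eigen_orthonormal heigen)
  (fun l : 'I_L => ip Omega s (ephi l)) (Ordinal kL)).
by rewrite subrr.
Qed.

Lemma subdomain_approximation :
  exists2 C : R, 0 <= C & forall v g n, W v ->
  is_operator_value Omega a V v g -> exists c : 'I_L -> R[i],
    energy_norm a (v - \sum_k c k *: phi n k) <=
      Num.sqrt (lam L) * L2norm Omega g
      + C * (lam L / lam L.-1) ^+ n * L2norm Omega v.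
Proof.
have Wp := semi_inner_sub Hp (local_subspace omega) WH.
have Wa := semi_inner_sub energy_semi_inner (local_subspace omega) WV.
have complete v (e : R) : W v -> 0 < e -> exists N (c : 'I_N -> R[i]),
    snorm (ip Omega) (v - \sum_(j < N) c j *: ephi j) < e.
  move=> Wv e0; have [N [c vc]] := eigen_complete heigen Wv e0.
  by exists N, c; rewrite comb_fctE.
have [C C0 CP] := local_approximation Wp Wa (eigen_local heigen)
  (eigen_gt0 heigen) (eigen_decreasing heigen) (eigen_orthonormal heigen)
  eigen_variational complete L_gt0 (lssi_local hphi) (lssi_step hphi)
  initial_approximation Hp WH.
exists C => // v g n Wv [Hg vg]; apply: CP => // w Ww; exact: vg (WV Ww).
Qed.

End local.

(** [form_aeq] concerns the first argument; hermitian symmetry transfers it to the second. *)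
Lemma energy_norm_aeq u v : V u -> V v -> aeq Omega u v ->
  energy_norm a u = energy_norm a v.
Proof.
move=> Vu Vv uv; rewrite /energy_norm (form_aeq ha Vu Vv Vu uv).
rewrite (form_hermitian ha Vu Vv) Re_conjc.
by rewrite (form_aeq ha Vu Vv Vv uv).
Qed.

(** * The LSSI space and Galerkin's optimality *)

Section galerkin.
Variables (N : nat) (L : 'I_N -> nat) (phi : forall i, nat -> 'I_(L i) -> fn).
Arguments phi : clear implicits.
Hypothesis phiV : forall i n k, V (phi i n k).

(** Members of the LSSI space are combinations of basis functions only up to equality a.e., under
    which [V] is closed among functions of [L2 Omega]. *)
Lemma lssi_space_sub n : lssi_space Omega phi n `<=` V.
Proof.
move=> w [Hw [ws [wsS wE]]].
have coef i : exists c : 'I_(L i) -> R[i],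
    aeq Omega (ws i) (\sum_k c k *: phi i n k).
  by have [_ [c cE]] := wsS i; exists c; rewrite comb_fctE.
(* [cid] rather than [choice], as the type of the coefficients depends on [i]. *)
pose c i := sval (cid (coef i)); have cE i := svalP (cid (coef i)).
apply: (space_aeq hV (u := \sum_i \sum_k c i k *: phi i n k)) => //.
  apply/aeq_sym/(aeq_trans wE); rewrite -fct_sumE; exact: aeq_sum.
apply: (linear_subspace_sum space_subspace) => i.
exact: linear_subspace_comb space_subspace _.
Qed.

Lemma lssi_space_comb n (c : forall i, 'I_(L i) -> R[i]) :
  lssi_space Omega phi n (\sum_i \sum_k c i k *: phi i n k).
Proof.
have Vc i : V (\sum_k c i k *: phi i n k).
  exact: linear_subspace_comb space_subspace _.
split; first by apply: space_L2; apply: linear_subspace_sum space_subspace _.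
exists (fun i => \sum_k c i k *: phi i n k); split.
  move=> i; split; first exact: space_L2.
  by exists (c i); rewrite comb_fctE; exact: aeq_refl.
by rewrite -fct_sumE; exact: aeq_refl.
Qed.

(** Galerkin orthogonality, tested with [uS] and with [w], makes [u - uS] energy-orthogonal to
    [uS - w]; Pythagoras concludes. *)
Lemma galerkin_quasi_optimal n f u uS w : is_solution a V Omega f u ->
  is_solution a (lssi_space Omega phi n) Omega f uS ->
  lssi_space Omega phi n w ->
  energy_norm a (u - uS) <= energy_norm a (u - w).
Proof.
move=> [Vu uf] [SuS uSf] Sw.
have VuS := lssi_space_sub SuS; have Vw := lssi_space_sub Sw.
have VS := space_subspace.
have -> : u - w = (u - uS) + (uS - w) by rewrite addrA subrK.
have orth v : lssi_space Omega phi n v -> a (u - uS) v = 0.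
  move=> Sv; have Vv := lssi_space_sub Sv.
  by rewrite (siBl energy_semi_inner) // uf // uSf // subrr.
apply: (orthogonal_snorm_le energy_semi_inner); [exact: linear_subspaceB..|].
rewrite (siBr energy_semi_inner) ?orth ?subrr //; exact: linear_subspaceB.
Qed.

End galerkin.
End global_problem.

(** * Assembly of the subdomain estimates *)

Unset Implicit Arguments.

Theorem theorem5p2 (R : realType) (d : nat)
  (Omega : set 'rV[R]_d) (m : nat) (GammaD : set 'rV[R]_d)
  (V : set ('rV[R]_d -> R[i]))
  (a : ('rV[R]_d -> R[i]) -> ('rV[R]_d -> R[i]) -> R[i])
  (hOmega : polyhedral_lipschitz_domain Omega)
  (hV : sobolev_space Omega m GammaD V)
  (ha : pde_form Omega m V a)
  (hwell : well_posed Omega a V Omega)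
  (Nc : nat) (omega : 'I_Nc -> set 'rV[R]_d) (chi : 'I_Nc -> 'rV[R]_d -> R[i])
  (hchi : partition_of_unity Omega V omega chi)
  (hlocal : forall i,
    well_posed Omega a (local_space Omega V (omega i)) (omega i))
  (lam : 'I_Nc -> nat -> R) (ephi : 'I_Nc -> nat -> 'rV[R]_d -> R[i])
  (heigen : forall i, eigenpairs Omega a V (omega i) (lam i) (ephi i))
  (L : 'I_Nc -> nat) (hL : forall i, (1 <= L i)%N)
  (phi : forall i, nat -> 'I_(L i) -> 'rV[R]_d -> R[i])
  (hphi : forall i, lssi_basis Omega a V (omega i) (phi i))
  (hinit : forall i,
    unique_preimages Omega (L i) (ephi i) (span_of Omega (phi i 0%N))) :
  exists (C : R) (eps : nat -> R),
    [/\ forall n, 0 <= eps n, eps @ \oo --> (0 : R) &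
      forall (f u uS : 'rV[R]_d -> R[i]) (n : nat),
        L2 Omega f ->
        is_solution a V Omega f u ->
        is_solution a (lssi_space Omega phi n) Omega f uS ->
        ((energy_norm a (fun x => u x - uS x))%:E <=
         (Num.sqrt (\big[Num.max/0]_(i < Nc) lam i (L i)))%:E *
           \sum_(i < Nc) operator_value_norm Omega a V (fun x => (chi i x * u x)%R)
         + (C * (\big[Num.max/0]_(i < Nc) (lam i (L i) / lam i (L i).-1)
                 + eps n) ^+ n
              * L2norm Omega u)%:E)%E].
Proof.
have oOmega : open Omega by case: hOmega => -[].
have mOmega := open_measurable_rV oOmega.
have oo i := cover_open hchi i.
have oO i : omega i `<=` Omega by rewrite (cover_eq hchi) => x; exists i.
have VS := space_subspace hV.
have Va := energy_semi_inner hV ha.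
have HV := space_L2 hV.
have phiV i n k : V (phi i n k) by have [] := lssi_local (hphi i) n k.
have local i := subdomain_approximation oOmega hV ha (oo i) (oO i) (hlocal i)
  (heigen i) (hL i) (hphi i) (hinit i).
pose K i := s2val (cid2 (local i)).
have K0 i : 0 <= K i := s2valP (cid2 (local i)).
have KP i := s2valP' (cid2 (local i)); rewrite -/(K _) in KP.
(* The maximum with 0 makes the bound nonnegative, as [L2norm_mul_le] requires. *)
have [M0 chiM0] := partition_bounded hchi; pose M := Num.max M0 0.
have M_ge0 : 0 <= M by rewrite le_max lexx orbT.
have chiM i x : Omega x -> `|chi i x| <= M%:C.
  by move=> Ox; apply: le_trans (chiM0 i x Ox) _; rewrite lecR le_max lexx.
(* [K i] comes from subdomain [i], and the factor [M] pays for passing from [chi i * u] to [u] in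
   the norm. The rate holds without correction, so [eps] is 0. *)
exists (\sum_i K i * M), (fun=> 0); split=> //; first exact: cvg_cst.
move=> f u uS n Hf usol uSsol; have [Vu uf] := usol.
have Wchi i := partition_local hchi i Vu.
have Vchi i : V (fun x => chi i x * u x) by have [] := Wchi i.
set Lam := \big[Num.max/0]_i lam i (L i).
set rho := \big[Num.max/0]_i (lam i (L i) / lam i (L i).-1).
have lam_gt0 i j : 0 < lam i j := eigen_gt0 (heigen i) j.
have ratio_ge0 i : 0 <= lam i (L i) / lam i (L i).-1.
  by apply: divr_ge0; exact: ltW.
have lamLam i : lam i (L i) <= Lam.
  exact: (le_bigmax _ (fun i => lam i (L i))).
have rho_le i : lam i (L i) / lam i (L i).-1 <= rho.
  exact: (le_bigmax _ (fun i => lam i (L i) / lam i (L i).-1)).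
have opn_ge0 i : 
    (0 <= operator_value_norm Omega a V (fun x => (chi i x * u x)%R))%E.
  rewrite /operator_value_norm; case: ifP => _; last exact: leey.
  by rewrite lee_fin sqrtr_ge0.
(* If some [chi i * u] has no operator value, the sum is [+oo]; the factor in front is positive, so
   the right side is [+oo] too. *)
have [gex|/existsNP[i0 gi0]] := pselect (forall i, exists g,
    is_operator_value Omega a V (fun x => chi i x * u x) g); last first.
  rewrite [X in (_ * X)%E](bigD1 i0) //=.
  rewrite {1}/operator_value_norm asboolF // addye; last first.
    by rewrite gt_eqF // (lt_le_trans (ltNyr 0)) // sume_ge0.
  rewrite gt0_muley ?addye ?leey // lte_fin sqrtr_gt0.
  exact: lt_le_trans (lam_gt0 i0 (L i0)) (lamLam i0).
pose g i := xget (fun=> 0)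
  [set g | is_operator_value Omega a V (fun x => chi i x * u x) g].
have gP i : is_operator_value Omega a V (fun x => chi i x * u x) (g i).
  by have [g0 g0P] := gex i; exact: (xgetI (fun=> 0) g0P).
under eq_bigr do rewrite /operator_value_norm asboolT //.
rewrite sumEFin -EFinM -EFinD lee_fin addr0.
have coef i := KP i _ _ n (Wchi i) (gP i).
pose c i := sval (cid (coef i)); have cP i := svalP (cid (coef i)).
rewrite -/(c _) in cP.
have Sw := lssi_space_comb hV phiV n c.
apply: le_trans (galerkin_quasi_optimal hV ha phiV usol uSsol Sw) _.
set w := \sum_i _ in Sw *.
have Vw := lssi_space_sub hV phiV Sw.
pose v i : 'rV[R]_d -> R[i] := fun x => chi i x * u x.
pose e i := v i - \sum_k c i k *: phi i n k.
have Ve i : V (e i).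
  apply: linear_subspaceB => //; first exact: Vchi.
  exact: linear_subspace_comb VS _.
(* The pieces [chi i * u] add up to [u] only almost everywhere. *)
have -> : energy_norm a (u - w) = energy_norm a (\sum_i e i).
  apply: (energy_norm_aeq ha).
  - exact: linear_subspaceB.
  - exact: linear_subspace_sum.
  have := partition_sum hchi; apply: filterS => x chi1 Ox.
  rewrite sumrB -/w !fctE fct_sumE; congr (_ - _).
  by rewrite -[LHS]mul1r -[in LHS]chi1 // mulr_suml.
apply: le_trans (snorm_sum Va Ve) _.
(* Both maxima dominate their local values, so the comparison is made for each [i] separately. *)
rewrite mulr_sumr !mulr_suml -big_split; apply: ler_sum => i _ /=.
apply: le_trans (cP i) _; apply: lerD.
  by rewrite ler_wpM2r ?sqrtr_ge0 // ler_wsqrtr.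
rewrite (_ : K i * M * rho ^+ n * L2norm Omega u =
  K i * rho ^+ n * (M * L2norm Omega u)); last by ring.
rewrite ler_pM ?sqrtr_ge0 //.
- by apply: mulr_ge0; [exact: K0|exact: exprn_ge0].
- apply: ler_wpM2l; first exact: K0.
  rewrite lerXn2r ?nnegrE //.
  exact: le_trans (ratio_ge0 i) (rho_le i).
- exact: (L2norm_mul_le mOmega M_ge0 (chiM i) (HV _ Vu) (HV _ (Vchi i))).
Qed.
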